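(* Let $\alpha\in(0,1)$ be an irrational number and let $(q_n)$ be the sequence of denominators of the convergents of the regular continued fraction of $\alpha$. Then $|t^s_{(q_n)}(\mathbb{T})\setminus t_{(q_n)}(\mathbb{T})|=\mathfrak{c}$.
   Context: $\mathfrak{c}$ is the cardinality of the continuum. $\mathbb{T}=\mathbb{R}/\mathbb{Z}$ is the circle group, and for $x\in\mathbb{T}$, $\|x\|$ denotes the distance of (any representative of) $x$ to the nearest integer. The regular continued fraction of an irrational $\alpha\in(0,1)$ is written $\alpha=[0;a_1,a_2,\dots]$ with convergents $\frac{p_n}{q_n}=[0;a_1,\dots,a_n]$ in lowest terms, $q_n>0$. For $A\subset\mathbb{N}$, the natural density is $d(A)=\lim_{n\to\infty}\frac{|A\cap[1,n]|}{n}$ when this limit exists. For a sequence of integers $(u_n)$, the characterized subgroup is $$t_{(u_n)}(\mathbb{T})=\{x\in\mathbb{T}: u_nx\to 0\text{ in }\mathbb{T}\},$$ and the statistically characterized subgroup is $$t^s_{(u_n)}(\mathbb{T})=\{x\in\mathbb{T}: \forall\varepsilon>0,\ d(\{n\in\mathbb{N}:\|u_nx\|\ge\varepsilon\})=0\}.$$ *)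

(* Defs.v *)
From HB Require Import structures.
From mathcomp Require Import all_boot all_order all_algebra.
From mathcomp Require Import ring.
From mathcomp Require Import all_classical all_reals all_analysis.
Import Order.TTheory GRing.Theory Num.Theory.
Import numFieldNormedType.Exports.

Set Implicit Arguments.
Unset Strict Implicit.
Unset Printing Implicit Defensive.

Local Open Scope classical_set_scope.
Local Open Scope quotient_scope.
Local Open Scope ring_scope.

Definition integers (R : realType) : {pred R} := [pred x | x \is a Num.int].

Lemma integers_zmod_closed (R : realType) : zmod_closed (@integers R).
Proof. by split=> [|x y xZ yZ]; rewrite inE ?int_num0// rpredB. Qed.

HB.instance Definition _ (R : realType) :=
  GRing.isZmodClosed.Build R (@integers R) (@integers_zmod_closed R).

(* R/Z with the quotient group structure and the quotient topology.  By
   circle_cvg0P below, convergence to 0 agrees with that of the metric induced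
   by circle_norm. *)
Definition circle (R : realType) : Type :=
  quotient_topology (Quotient.quot (@integers R : zmodClosed R)).

HB.instance Definition _ (R : realType) :=
  Quotient.copy (circle R)
    (quotient_topology (Quotient.quot (@integers R : zmodClosed R))).
HB.instance Definition _ (R : realType) :=
  PointedTopological.copy (circle R)
    (quotient_topology (Quotient.quot (@integers R : zmodClosed R))).
HB.instance Definition _ (R : realType) :=
  GRing.Zmodule.copy (circle R) (Quotient.quot (@integers R : zmodClosed R)).

Lemma circle_piD (R : realType) :
  {morph \pi_(circle R) : x y / x + y >-> x + y}.
Proof. exact: Quotient.pi_add. Qed.

Lemma circle_piP (R : realType) (x y : R) :
  \pi_(circle R) x = \pi_(circle R) y <-> x - y \is a Num.int.
Proof.
have E := Quotient.idealrBE (@integers R : zmodClosed R) x y.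
split=> [xy|xyZ].
  have : x - y \in @integers R by rewrite E; apply/eqP; exact: xy.
  by rewrite inE.
have : x - y \in @integers R by rewrite inE.
by rewrite E => /eqP.
Qed.

Definition dist_int (R : realType) (r : R) : R :=
  inf [set `|r - m%:~R| | m in [set: int]].

Definition circle_norm (R : realType) (x : circle R) : R := dist_int (repr x).

Section circle_norm_theory.
Variable R : realType.
Implicit Types (r s e : R) (x : circle R).

Lemma dist_int_le r (m : int) : dist_int r <= `|r - m%:~R|.
Proof. by apply: ge_inf; [exists 0 => _ [k _ <-]|exists m]. Qed.

Lemma dist_int_ltP r e :
  dist_int r < e <-> exists m : int, `|r - m%:~R| < e.
Proof.
split=> [/inf_lt[]|[m]]; last exact/le_lt_trans/dist_int_le.
- by exists `|r - 0%:~R|, 0.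
- by move=> _ [m _ <-]; exists m.
Qed.

Lemma dist_int_ge0 r : 0 <= dist_int r.
Proof. by apply: lb_le_inf; [exists `|r - 0%:~R|, 0|move=> _ [k _ <-]]. Qed.

Lemma dist_intDz r (m : int) : dist_int (r + m%:~R) = dist_int r.
Proof.
congr inf; apply/seteqP; split=> _ [k _ <-].
  by exists (k - m) => //; congr `|_|; rewrite intrB; ring.
by exists (k + m) => //; congr `|_|; rewrite intrD; ring.
Qed.

Lemma circle_normE r : circle_norm (\pi_(circle R) r) = dist_int r.
Proof.
rewrite /circle_norm.
have /circle_piP/intrP[m /eqP] : \pi_(circle R) (repr (\pi_(circle R) r)) =
  \pi_(circle R) r by rewrite reprK.
by rewrite subr_eq addrC => /eqP ->; rewrite dist_intDz.
Qed.

Lemma circle_norm_continuous : continuous (@circle_norm R).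
Proof.
have lip r s : dist_int r <= dist_int s + `|r - s|.
  rewrite leNgt -ltrBDr; apply/negP => /dist_int_ltP[m].
  rewrite ltrBrDr ltNge => /negP; apply.
  rewrite (le_trans (dist_int_le r m))//.
  by rewrite (_ : r - m%:~R = (s - m%:~R) + (r - s)) ?ler_normD//; ring.
have cts : continuous (@dist_int R).
  move=> r; apply/cvgrPdist_lt => e e0; near=> s.
  apply: (@le_lt_trans _ _ `|r - s|); last by near: s; exact: cvgr_dist_lt.
  by rewrite ler_norml lerBlDl lip lerBrDr addrC lerBlDr distrC lip.
apply: (repr_comp_continuous (Q0 := Quotient.quot (@integers R : zmodClosed R))
  cts) => r s /eqP/circle_piP/intrP[m /eqP].
by rewrite subr_eq addrC => /eqP ->; rewrite dist_intDz.
Unshelve. all: by end_near. Qed.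

Lemma circle_cvg0P (v : nat -> circle R) :
  v @ \oo --> (0 : circle R) <-> circle_norm (v n) @[n --> \oo] --> (0 : R).
Proof.
have pi0 : \pi_(circle R) 0 = 0 :> circle R.
  by apply: (addrI (\pi_(circle R) 0)); rewrite -circle_piD !addr0.
have norm0 : circle_norm (0 : circle R) = 0.
  rewrite -pi0 circle_normE; apply/eqP; rewrite eq_le dist_int_ge0 andbT.
  by rewrite (le_trans (dist_int_le 0 0))// subr0 normr0.
split=> [v0|v0].
  have := @circle_norm_continuous (0 : circle R).
  rewrite /continuous_at norm0 => c0; apply: (cvg_comp _ _ v0); exact: c0.
move=> U; rewrite nbhsE => -[V [oV V0] VU].
have : nbhs (0 : R) (\pi_(circle R) @^-1` V).
  by apply: open_nbhs_nbhs; split; [exact: oV|rewrite /= pi0].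
move=> /nbhs_ballP[e /= e0 eV].
move/cvgrPdist_lt : v0 => /(_ e e0) [N _ vN]; exists N => // n /vN /=.
rewrite sub0r normrN ger0_norm ?dist_int_ge0// => /dist_int_ltP[m rm].
apply: VU; rewrite /= -[v n]reprK.
rewrite (_ : \pi_(circle R) _ = \pi_(circle R) (repr (v n) - m%:~R)).
  by apply: eV; rewrite /ball /= sub0r normrN.
by apply/circle_piP/intrP; exists m; ring.
Qed.

End circle_norm_theory.

(* The natural density of A exists and equals d; only the elements of A in
   [1, n] are counted, so whether 0 belongs to A is irrelevant. *)
Definition natural_density (R : realType) (A : set nat) (d : R) : Prop :=
  (count (mem A) (iota 1 n))%:R / n%:R @[n --> \oo] --> d.

Definition characterized_subgroup (R : realType) (u : nat -> int) :
    set (circle R) :=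
  [set x | x *~ u n @[n --> \oo] --> (0 : circle R)].
Arguments characterized_subgroup R u : clear implicits.

Definition stat_characterized_subgroup (R : realType) (u : nat -> int) :
    set (circle R) :=
  [set x | forall e : R, 0 < e ->
    natural_density [set n | e <= circle_norm (x *~ u n)] (0 : R)].
Arguments stat_characterized_subgroup R u : clear implicits.

Definition gauss_map (R : realType) (x : R) : R :=
  x^-1 - (Num.floor (x^-1))%:~R.

(* Zero-based: cf_digit alpha n is the partial quotient a_(n+1) of
   alpha = [0; a_1, a_2, ...], for alpha in (0, 1) irrational. *)
Definition cf_digit (R : realType) (alpha : R) (n : nat) : int :=
  Num.floor ((iter n (@gauss_map R) alpha)^-1).

(* [0; a_1, ..., a_n]; the value is 0 for n = 0. *)
Definition convergent (R : realType) (alpha : R) (n : nat) : rat :=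
  foldr (fun (a : int) (r : rat) => (a%:~R + r)^-1) 0
    (mkseq (cf_digit alpha) n).

Definition convergent_den (R : realType) (alpha : R) (n : nat) : int :=
  denq (convergent alpha n).

(* Main.v *)
(** With theta_k = q_k alpha - p_k, take x = sum_k c_k theta_k for integers c_k
  supported on a sparse set S.  Modulo 1, q_n theta_k = q_k theta_n, so that
  the terms with k < n contribute at most sum_(k < n) |c_k| q_k |theta_n| to
  q_n x and those with k > n at most sum_(k > n) q_n |c_k theta_k|.  As
  q_(n+2) >= 2 q_n, both decay exponentially in the distance from n to
  S \ {n}.  Hence q_n x is close to 0 unless n is close to S, which happens
  with density 0, whereas at an isolated n in S it is close to
  c_n q_n theta_n, which is kept away from the integers by the choice of c_n.
  Switching the coefficients on S on and off according to a sequence of bits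
  gives continuum many such x: the difference of two of them is again of this
  form, and does not vanish modulo 1 if infinitely many coefficients differ. *)
Require Import Defs.
From mathcomp Require Import all_boot all_order all_algebra.
From mathcomp Require Import all_classical all_reals all_analysis.
From mathcomp Require Import zify ring lra.
Import Order.TTheory GRing.Theory Num.Theory.
Import numFieldNormedType.Exports.
Local Open Scope classical_set_scope.
Local Open Scope card_scope.
Local Open Scope ring_scope.

Set Implicit Arguments.
Unset Strict Implicit.
Unset Printing Implicit Defensive.

(** * Continued fraction recurrences *)

Fixpoint continuant (a : nat -> int) (u : int * int) (n : nat) : int * int :=
  if n is m.+1 then
    let v := continuant a u m in (v.2, a m * v.2 + v.1)
  else u.

(* p_n and q_n; the first components hold the index shifted by one, starting
   from p_(-1) = 1 and q_(-1) = 0. *)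
Definition cf_num a := continuant a (1, 0).
Definition cf_den a := continuant a (0, 1).

Section cf_recurrence.
Variable a : nat -> int.
Hypothesis a_ge1 : forall n, 1 <= a n.

Lemma cf_den_ge n :
  1 <= (cf_den a n).2 /\ 0 <= (cf_den a n).1 <= (cf_den a n).2.
Proof.
elim: n => //= n [h1 h2]; have := a_ge1 n.
by rewrite /cf_den /= -/(cf_den a n); nia.
Qed.

Lemma cf_det n :
  (cf_num a n).1 * (cf_den a n).2 - (cf_num a n).2 * (cf_den a n).1 = (-1) ^+ n.
Proof.
elim: n => //= n IH; rewrite exprS -IH /cf_num /cf_den /=.
by rewrite -/(cf_den a n) -/(cf_num a n); ring.
Qed.

Lemma coprime_cf n : coprime `|(cf_num a n).2| `|(cf_den a n).2|.
Proof.
suff : coprimez (cf_num a n).2 (cf_den a n).2 by [].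
apply/coprimezP.
(* Bezout coefficients: [cf_det] multiplied by its right-hand side, which squares to 1. *)
exists (- (-1) ^+ n * (cf_den a n).1, (-1) ^+ n * (cf_num a n).1).
rewrite /=; transitivity ((-1) ^+ n * (-1) ^+ n : int); last first.
  by rewrite -expr2 sqrr_sign.
by rewrite -{3}cf_det; ring.
Qed.

(** The free tail [r] makes the induction work: the last digit is absorbed into it as
    [(a n + r)^-1]. Convergents are the case [r = 0]. *)
Lemma foldr_cf (F : realFieldType) n (r : F) : 0 <= r ->
  foldr (fun (b : int) s => (b%:~R + s)^-1) r (mkseq a n) =
  ((cf_num a n).2%:~R + r * (cf_num a n).1%:~R) /
  ((cf_den a n).2%:~R + r * (cf_den a n).1%:~R).
Proof.
elim: n r => [|n IH] r r0; first by rewrite /= mulr1 mulr0 addr0 add0r divr1.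
rewrite /mkseq -addn1 iotaD map_cat foldr_cat /= add0n addn1.
have a1 : (1 : F) <= (a n)%:~R by rewrite ler1z.
have ar0 : 0 < (a n)%:~R + r by rewrite ltr_wpDr// (lt_le_trans ltr01).
rewrite -/(mkseq a n) IH ?invr_ge0 1?ltW//.
rewrite /cf_num /cf_den /= -/(cf_den a n) -/(cf_num a n) !intrD !intrM.
have [d2 /andP[d1 _]] := cf_den_ge n.
have D2 : (1 : F) <= (cf_den a n).2%:~R by rewrite ler1z.
have D1 : (0 : F) <= (cf_den a n).1%:~R by rewrite ler0z.
have ar1 := lt0r_neq0 ar0; field; rewrite ar1 andbT.
by apply: lt0r_neq0; nra.
Qed.

End cf_recurrence.

(** * The Gauss map on irrational numbers *)

Section gauss.
Variable R : realType.
Implicit Type x : R.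

Lemma irrational_neq0 x : irrational x -> x != 0.
Proof.
by move=> xirr; apply/eqP => x0; apply: xirr; exists 0; rewrite // x0 raddf0.
Qed.

Lemma irrational_gauss x : irrational x -> irrational (gauss_map x).
Proof.
move=> xirr [s _ sx]; apply: xirr; exists (s + (Num.floor x^-1)%:~R)^-1 => //.
by rewrite fmorphV rmorphD /= sx ratr_int subrK invrK.
Qed.

Lemma gauss_itv x : irrational x -> 0 < gauss_map x < 1.
Proof.
move=> /irrational_gauss/irrational_neq0 g0.
rewrite lt_neqAle eq_sym g0 /gauss_map subr_ge0 floor_le /=.
by rewrite ltrBlDl -intrD1 floorD1_gt.
Qed.

End gauss.

(** * Convergents of [alpha] and their errors *)

Section alpha.
Variables (R : realType) (alpha : R).
Hypotheses (alpha01 : 0 < alpha < 1) (alpha_irr : irrational alpha).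

Let r n := iter n (@gauss_map R) alpha.
Let a := cf_digit alpha.

Let r_itv n : 0 < r n < 1.
Proof.
have irr m : irrational (r m) by elim: m => //= m; exact: irrational_gauss.
by case: n => //= n; exact: gauss_itv.
Qed.

Lemma cf_digit_ge1 n : 1 <= a n.
Proof.
have /andP[r0 r1] := r_itv n.
by rewrite -gtz0_ge1 floor_gt0 invf_ge1// ltW.
Qed.

Lemma convergent_denE n : convergent_den alpha n = (cf_den a n).2.
Proof.
rewrite /convergent_den /convergent foldr_cf//; last exact: cf_digit_ge1.
rewrite !mul0r !addr0 coprimeq_den; last exact: coprime_cf.
by have [d1 _] := cf_den_ge cf_digit_ge1 n; rewrite -/a; case: eqP => [|_]; lia.
Qed.

Let rE n : r n * ((a n)%:~R + r n.+1) = 1.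
Proof.
have /andP[r0 _] := r_itv n.
by rewrite /r iterS /gauss_map addrC subrK divff// gt_eqF.
Qed.

(** The error [q_n alpha - p_n] (see [cf_err_num]), in a form that shows its sign and size. *)
Definition cf_err n : R := (-1) ^+ n * \prod_(i < n.+1) r i.

Lemma cf_err_num n : (cf_den a n).2%:~R * alpha - (cf_num a n).2%:~R = cf_err n.
Proof.
(* Two consecutive errors are carried through the induction, starting from index -1, and [rE] closes
   the recurrence. *)
suff [_ //] : (cf_den a n).1%:~R * alpha - (cf_num a n).1%:~R =
    - (-1) ^+ n * \prod_(i < n) r i /\
  (cf_den a n).2%:~R * alpha - (cf_num a n).2%:~R = cf_err n.
rewrite /cf_err; elim: n => [|n [IH1 IH2]].
  by rewrite big_ord0 big_ord1 /=; split; ring.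
rewrite /cf_num /cf_den /= -/(cf_num a n) -/(cf_den a n); split.
  by rewrite IH2 exprS; ring.
transitivity ((a n)%:~R * ((cf_den a n).2%:~R * alpha - (cf_num a n).2%:~R) +
  ((cf_den a n).1%:~R * alpha - (cf_num a n).1%:~R)).
  by rewrite !intrD !intrM; ring.
rewrite IH1 IH2 exprS !big_ord_recr /=.
have := congr1 (GRing.mul ((-1) ^+ n * \prod_(i < n) r i)) (rE n).
rewrite -[gauss_map (r n)]/(r n.+1).
by move: (\prod_(i < n) _) ((-1) ^+ n) => P S; lra.
Qed.

Lemma cf_err_norm n : `|cf_err n| = \prod_(i < n.+1) r i.
Proof.
rewrite normrM normrX normrN1 expr1n mul1r ger0_norm//.
by apply: prodr_ge0 => i _; have /andP[/ltW] := r_itv i.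
Qed.

Lemma convergent_den_ge1 n : 1 <= convergent_den alpha n.
Proof. by rewrite convergent_denE; have [] := cf_den_ge cf_digit_ge1 n. Qed.

Lemma convergent_den_leS n :
  convergent_den alpha n <= convergent_den alpha n.+1.
Proof.
rewrite !convergent_denE /cf_den /= -/(cf_den a n).
by have [] := cf_den_ge cf_digit_ge1 n; have := cf_digit_ge1 n; nia.
Qed.

Lemma convergent_den_rec n : convergent_den alpha n.+2 =
  a n.+1 * convergent_den alpha n.+1 + convergent_den alpha n.
Proof. by rewrite !convergent_denE. Qed.

Lemma convergent_den_leD n :
  convergent_den alpha n + convergent_den alpha n.+1 <=
  convergent_den alpha n.+2.
Proof.
rewrite convergent_den_rec.
by have := convergent_den_ge1 n.+1; have := cf_digit_ge1 n.+1; nia.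
Qed.

(** This is the determinant identity rewritten for errors of alternating sign; here it follows by
    induction from [rE]. *)
Lemma cf_err_den n : `|cf_err n| * (convergent_den alpha n.+1)%:~R +
  `|cf_err n.+1| * (convergent_den alpha n)%:~R = 1.
Proof.
rewrite !cf_err_norm; elim: n => [|n IH].
  rewrite !convergent_denE !big_ord_recr !big_ord0 /cf_den /= mulr1 addr0.
  by have := rE 0; rewrite /= -/a; lra.
have := congr1 (GRing.mul ((\prod_(i < n) r i) * r n *
  (convergent_den alpha n.+1)%:~R)) (rE n.+1).
by move: IH; rewrite !big_ord_recr /= convergent_den_rec intrD intrM; lra.
Qed.

(** The two terms [q_n q_k alpha] cancel. Modulo 1, this exchanges the indices of denominator and
    error. *)
Lemma cf_err_int n k : (convergent_den alpha n)%:~R * cf_err k -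
  (convergent_den alpha k)%:~R * cf_err n \is a Num.int.
Proof.
rewrite -!cf_err_num !convergent_denE; apply/intrP.
exists ((cf_den a k).2 * (cf_num a n).2 - (cf_den a n).2 * (cf_num a k).2).
by rewrite intrB !intrM; ring.
Qed.

End alpha.

(** * Density and distance to the integers *)

Lemma natural_density0 (R : realType) (A : set nat) (C : nat) :
  (forall n, (count (mem A) (iota 1 n) ^ 2 <= C * n)%N) ->
  natural_density A (0 : R).
Proof.
move=> AC; apply/cvgrPdist_lt => e e0; near=> n.
have n0 : 0 < n%:R :> R by rewrite ltr0n; near: n; exact: nbhs_infty_gt.
have nC : C%:R / e ^+ 2 < n%:R by near: n; exact: nbhs_infty_gtr.
rewrite sub0r normrN ger0_norm ?divr_ge0// ltr_pdivrMr//.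
rewrite -(@ltr_pXn2r _ 2)// ?nnegrE// ?mulr_ge0// 1?ltW//.
have : (count (mem A) (iota 1 n) ^ 2)%:R <= (C * n)%:R :> R by rewrite ler_nat.
rewrite natrX natrM => /le_lt_trans; apply.
rewrite exprMn [_%:R ^+ 2]expr2 mulrA ltr_pM2r//.
by rewrite mulrC -ltr_pdivrMr ?exprn_gt0.
Unshelve. all: by end_near. Qed.

Lemma sqr_le_exp2 j : (j.+1 ^ 2 <= 4 * 2 ^ j)%N.
Proof.
elim: j => [|[|[|j]] IH] //.
by rewrite (expnS 2); move: IH; rewrite -!mulnn; nia.
Qed.

(** Up to [n], the set is covered by O(log n) windows of [E + 1] points, and (log n)^2 is O(n). The
    shift [D] lets a window start below its power of 2. *)
Lemma natural_density_near_exp2 (R : realType) (A : set nat) (D E : nat) :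
  (forall n, A n -> exists j, 2 ^ j <= n + D <= 2 ^ j + E)%N ->
  natural_density A (0 : R).
Proof.
move=> AE; apply: (@natural_density0 _ _ (4 * D.+1 * E.+1 ^ 2)) => -[|n] //.
pose J := (trunc_log 2 (n.+1 + D)).+1.
pose s := [seq (2 ^ j + i - D)%N | j <- iota 0 J, i <- iota 0 E.+1].
have As : (count (mem A) (iota 1 n.+1) <= J * E.+1)%N.
  have -> : (J * E.+1 = size s)%N by rewrite size_allpairs !size_iota.
  rewrite -size_filter; apply: uniq_leq_size.
    by rewrite filter_uniq ?iota_uniq.
  move=> k; rewrite mem_filter mem_iota => /andP[/set_mem/AE[j jk] k1].
  apply/allpairsP; exists (j, k + D - 2 ^ j)%N.
  rewrite !mem_iota /=; split; try lia.
  by rewrite /J ltnS; apply: trunc_log_max => //; lia.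
have J2 : (J ^ 2 <= 4 * (n.+1 + D))%N.
  apply: leq_trans (sqr_le_exp2 _) _; rewrite leq_mul2l /=.
  by have /andP[] := @trunc_log_bounds 2 (n.+1 + D) isT isT.
apply: (@leq_trans ((J * E.+1) ^ 2)); first by rewrite leq_exp2r.
rewrite expnMn; apply: (@leq_trans (4 * (n.+1 + D) * E.+1 ^ 2)).
  by rewrite leq_mul2r J2 orbT.
rewrite [leqRHS]mulnAC leq_mul2r; apply/orP; right; nia.
Qed.

Section dist_int_lemmas.
Variable R : realType.
Implicit Types r s e : R.

Lemma dist_int_near r s e (z : int) :
  `|r - s - z%:~R| <= e -> dist_int r <= dist_int s + e.
Proof.
move=> rs; rewrite -lerBlDr leNgt; apply/negP => /dist_int_ltP[m sm].
have := dist_int_le r (m + z); apply/negP; rewrite -ltNge.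
rewrite (_ : r - _ = (r - s - z%:~R) + (s - m%:~R)); last first.
  by rewrite intrD; ring.
by rewrite (le_lt_trans (ler_normD _ _))//; lra.
Qed.

Lemma dist_int_int r : r \is a Num.int -> dist_int r = 0.
Proof.
move=> /intrP[m ->]; apply/eqP; rewrite eq_le dist_int_ge0 andbT.
by rewrite (le_trans (dist_int_le _ m))// subrr normr0.
Qed.

Lemma dist_int_ge r e : e <= 1 / 2 -> e <= `|r| <= 1 - e -> e <= dist_int r.
Proof.
move=> e2 /andP[er re]; rewrite leNgt; apply/negP => /dist_int_ltP[m rm].
have [m0|m0] := eqVneq m 0; first by move: rm; rewrite m0 subr0; lra.
have : 1 <= `|m%:~R| :> R by rewrite norm_intr_ge1 ?intr_int ?intr_eq0.
have := ler_normD (m%:~R - r) r; rewrite subrK distrC; lra.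
Qed.

End dist_int_lemmas.

(** * Ostrowski expansions *)

Section ostrowski.
Variables (R : realType) (q : nat -> int) (th : nat -> R).
Hypotheses (q_ge1 : forall n, 1 <= q n) (q_leS : forall n, q n <= q n.+1).
Hypothesis q_leD : forall n, q n + q n.+1 <= q n.+2.
Hypothesis th_q : forall n,
  `|th n| * (q n.+1)%:~R + `|th n.+1| * (q n)%:~R = 1.
Hypothesis th_int : forall n k,
  (q n)%:~R * th k - (q k)%:~R * th n \is a Num.int.

Local Notation Q n := ((q n)%:~R : R).

Let Q_ge1 n : 1 <= Q n. Proof. by rewrite ler1z. Qed.
Let Q_gt0 n : 0 < Q n. Proof. exact: lt_le_trans (Q_ge1 n). Qed.
Let Q_leS n : Q n <= Q n.+1. Proof. by rewrite ler_int. Qed.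
Let Q_leD n : Q n + Q n.+1 <= Q n.+2. Proof. by rewrite -intrD ler_int. Qed.

Lemma den_doubling n d : 2 ^+ d * Q n <= Q (n + d.*2)%N.
Proof.
elim: d => [|d IH]; first by rewrite addn0 expr0 mul1r.
rewrite doubleS !addnS exprS.
by have := Q_leD (n + d.*2); have := Q_leS (n + d.*2); move: IH; lra.
Qed.

Lemma err_den_le1 n : `|th n| * Q n.+1 <= 1.
Proof.
have := th_q n; have : 0 <= `|th n.+1| * Q n by rewrite mulr_ge0// ltW.
lra.
Qed.

(** In [th_q] the other term is at most q_n / q_(n+2), hence at most 1/2. *)
Lemma err_den_ge n : 1 / 2 <= `|th n| * Q n.+1.
Proof.
have := th_q n; have := err_den_le1 n.+1; have := Q_leD n; have := Q_leS n.
by have := normr_ge0 (th n.+1); have := Q_ge1 n; nra.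
Qed.

Lemma err_gt0 n : 0 < `|th n|.
Proof.
rewrite normr_gt0; apply/eqP => t0; have := err_den_ge n.
by rewrite t0 normr0 mul0r; lra.
Qed.

(* The numbers u = |th n| q_(n+1) and v = |th (n+1)| q_n satisfy u + v = 1,
   hence u v <= 1/4, and u v is also the product of the two quantities. *)
Lemma err_den_small n :
  `|th n| * Q n <= 1 / 2 \/ `|th n.+1| * Q n.+1 <= 1 / 2.
Proof.
case: (lerP (`|th n| * Q n) (1 / 2)) => [|h1]; [by left|right].
rewrite leNgt; apply/negP => h2.
have := th_q n; set u := _ * Q n.+1; set v := `|th n.+1| * Q n => uv.
have : 1 / 2 * (1 / 2) < u * v.
  rewrite (_ : u * v = (`|th n| * Q n) * (`|th n.+1| * Q n.+1)); last first.
    by rewrite /u /v; ring.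
  by apply: ltr_pM => //; lra.
by rewrite (_ : v = 1 - u); [have := sqr_ge0 (2 * u - 1); nra|lra].
Qed.

(** With t = |th n| q_n, this is the least integer w such that w t > 1/4; then w t <= 1/4 + t, which
    is at most 3/4 when t <= 1/2. *)
Definition weight n : int := (Num.trunc (4 * (`|th n| * Q n))^-1).+1.

Lemma weight_itv n : `|th n| * Q n <= 1 / 2 ->
  1 / 4 <= (weight n)%:~R * (`|th n| * Q n) <= 3 / 4.
Proof.
have : 0 < `|th n| * Q n by rewrite mulr_gt0// err_gt0.
rewrite /weight -pmulrn; set t := _ * _ => t0 tle.
have /truncn_itv/andP[] : 0 <= (4 * t)^-1 by rewrite invr_ge0; lra.
rewrite -(natr1 (Num.trunc _)) -[_^-1]mul1r.
rewrite ler_pdivlMr ?ltr_pdivrMr ?mulr_gt0 ?err_gt0//.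
by move: ((Num.trunc _)%:R) => k h1 h2; apply/andP; split; lra.
Qed.

Lemma sum_inv_den m N : (m <= N)%N -> \sum_(m <= k < N) (Q k)^-1 <= 4 / Q m.
Proof.
(* The increment of [f] at [k] is 2/q_k - 2/q_(k+2), which is at least 1/q_k. *)
move=> mN; pose f k := - 2 * ((Q k)^-1 + (Q k.+1)^-1).
have iQ k : 0 < (Q k)^-1 by rewrite invr_gt0.
have iQS k : (Q k.+1)^-1 <= (Q k)^-1 by rewrite lef_pV2 ?posrE.
apply: (@le_trans _ _ (f N - f m)).
  rewrite -telescope_sumr//; apply: ler_sum_nat => k _.
  have : (Q k.+2)^-1 <= (2 * Q k)^-1.
    rewrite lef_pV2 ?posrE ?mulr_gt0//.
    by have := Q_leD k; have := Q_leS k; lra.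
  by rewrite invfM /f; have := iQ k; lra.
by rewrite /f; have := iQ N; have := iQ N.+1; have := iQS m; lra.
Qed.

Lemma sum_denS m : \sum_(0 <= k < m) Q k.+1 <= 2 * Q m.+1.
Proof.
pose f k := Q k + Q k.+1.
apply: (@le_trans _ _ (f m - f 0%N)).
  rewrite -telescope_sumr//; apply: ler_sum_nat => k _.
  by rewrite /f; have := Q_leD k; lra.
by rewrite /f; have := Q_leS m; have := Q_gt0 0; have := Q_gt0 1; lra.
Qed.

(** Signed digits are allowed, without the usual Ostrowski digit rules, so that differences of
    expansions are again expansions. *)
Definition ostrowski (c : nat -> int) : R :=
  limn (series (fun k => (c k)%:~R * th k)).

Section expansion.
Variable c : nat -> int.
Hypothesis c_le : forall k, `|(c k)%:~R| * (`|th k| * Q k) <= 1.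

Let term_le k : `|(c k)%:~R * th k| <= (Q k)^-1.
Proof. by rewrite -[_^-1]mul1r ler_pdivlMr// normrM -mulrA. Qed.

Lemma is_cvg_ostrowski : cvgn (series (fun k => (c k)%:~R * th k)).
Proof.
apply: normed_cvg; apply: nondecreasing_is_cvgn.
  by apply: nondecreasing_series => k _ _; exact: normr_ge0.
exists (4 / Q 0) => _ [n _ <-].
rewrite (le_trans _ (sum_inv_den (leq0n n)))//.
by apply: ler_sum_nat => k _; exact: term_le.
Qed.

Lemma ostrowski_tail m :
  `|ostrowski c - \sum_(0 <= k < m) (c k)%:~R * th k| <= 4 / Q m.
Proof.
have near_m : \forall N \near \oo,
    `|series (fun k => (c k)%:~R * th k) N - \sum_(0 <= k < m) (c k)%:~R * th k|
      <= 4 / Q m.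
  near=> N; have mN : (m <= N)%N by near: N; exact: nbhs_infty_ge.
  rewrite /series /= (big_cat_nat (n := m))//= addrAC subrr add0r.
  rewrite (le_trans (ler_norm_sum _ _ _))// (le_trans _ (sum_inv_den mN))//.
  by apply: ler_sum_nat => k _; exact: term_le.
rewrite ler_distl; apply/andP; split.
  apply: limr_ge; first exact: is_cvg_ostrowski.
  by apply: filterS near_m => N; rewrite ler_distl => /andP[].
apply: limr_le; first exact: is_cvg_ostrowski.
by apply: filterS near_m => N; rewrite ler_distl => /andP[].
Unshelve. all: by end_near. Qed.

Lemma coef_den_le k : `|(c k)%:~R| * Q k <= 2 * Q k.+1.
Proof.
have := c_le k; have := err_den_ge k; have t0 := err_gt0 k.
rewrite mulrCA => h1 h2; rewrite -(ler_pM2l t0); lra.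
Qed.

(** Replacing each [Q n * th k] by [Q k * th n] changes the sum by an integer. What remains is
    [th n], of size at most 1/q_(n+1), times a sum controlled by [coef_den_le] and [sum_denS]. *)
Lemma head_le m n : exists z : int,
  `|Q n * (\sum_(0 <= k < m) (c k)%:~R * th k) - z%:~R| <=
  4 * Q m.+1 / Q n.+1.
Proof.
pose S : R := \sum_(0 <= k < m) (c k)%:~R * (Q n * th k - Q k * th n).
have /intrP[z Sz] : S \is a Num.int.
  by apply: rpred_sum => k _; rewrite rpredM// intr_int.
exists z; rewrite -Sz /S mulr_sumr -sumrB.
rewrite (eq_bigr (fun k => (c k)%:~R * Q k * th n)); last by move=> k _; ring.
rewrite -mulr_suml normrM.
have h1 : `|\sum_(0 <= k < m) (c k)%:~R * Q k| <= 4 * Q m.+1.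
  rewrite (le_trans (ler_norm_sum _ _ _))//.
  apply: (@le_trans _ _ (\sum_(0 <= k < m) 2 * Q k.+1)).
    apply: ler_sum_nat => k _; rewrite normrM (gtr0_norm (Q_gt0 _)).
    exact: coef_den_le.
  by rewrite -mulr_sumr; have := sum_denS m; lra.
by rewrite ler_pM// -[_^-1]mul1r ler_pdivlMr// err_den_le1.
Qed.

Lemma ostrowski_local n d :
  (forall k, k != n -> (n <= k + d.*2)%N -> (k <= n + d.*2)%N -> c k = 0) ->
  exists z : int,
    `|Q n * ostrowski c - (c n)%:~R * (Q n * th n) - z%:~R| <= 8 / 2 ^+ d.
Proof.
move=> c0; pose u k : R := (c k)%:~R * th k; pose m := (n - d.*2)%N.
have d2 : 0 < 2 ^+ d :> R by rewrite exprn_gt0.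
have [z head] : exists z : int,
    `|Q n * (\sum_(0 <= k < m) u k) - z%:~R| <= 4 / 2 ^+ d.
  have [dn|nd] := leqP d.*2 n.
    have [z hz] := head_le m n; exists z; apply: le_trans hz _.
    rewrite -mulrA ler_pM2l// ler_pdivrMr// mulrC ler_pdivlMr// mulrC.
    by have := den_doubling m.+1 d; rewrite addSn /m subnK.
  (* Truncated subtraction gives [m = 0] here, so the head is empty. *)
  exists 0; rewrite /m (eqP (ltnW nd)) big_geq// mulr0 subr0 normr0.
  by rewrite divr_ge0// ltW.
exists z.
(* Between [m] and [n + d.*2] only the term at [n] survives. *)
have sumE : \sum_(0 <= k < n + d.*2) u k + u (n + d.*2)%N =
    \sum_(0 <= k < m) u k + u n.
  rewrite -big_nat_recr//= (big_cat_nat (n := m))//=; last by rewrite /m; lia.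
  congr +%R; rewrite (bigD1_seq n) ?mem_index_iota ?iota_uniq//=; last first.
    by rewrite /m; lia.
  rewrite big_nat_cond big1 ?addr0// => k /andP[km kn].
  by rewrite /u c0 ?mul0r//; move: km; rewrite /m; lia.
have t2 := ostrowski_tail (n + d.*2).+1.
rewrite big_nat_recr//= -/(u _) [X in _ - (X + _)](eq_bigr u)// sumE in t2.
set X := ostrowski c in t2 *.
have tail : `|Q n * (X - (\sum_(0 <= k < m) u k + u n))| <= 4 / 2 ^+ d.
  rewrite normrM (gtr0_norm (Q_gt0 n)).
  apply: (@le_trans _ _ (Q n * (4 / Q (n + d.*2).+1))).
    by rewrite ler_pM2l.
  rewrite mulrCA ler_pM2l// ler_pdivrMr// mulrC ler_pdivlMr// mulrC.
  exact: le_trans (den_doubling n d) (Q_leS _).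
rewrite (_ : _ - _ - _ = (Q n * (\sum_(0 <= k < m) u k) - z%:~R) +
  (Q n * (X - (\sum_(0 <= k < m) u k + u n)))); last by rewrite /u; ring.
by rewrite (le_trans (ler_normD _ _))//; lra.
Qed.

End expansion.

(** * Sparse coefficients *)

(** By [err_den_small], one of the two candidates satisfies the hypothesis of [weight_itv]. *)
Definition sparse_index j : nat :=
  if `|th (2 ^ j)%N| * Q (2 ^ j)%N <= 1 / 2 then (2 ^ j)%N else (2 ^ j).+1.

Definition sparse_coef (eps : nat -> int) k : int :=
  let j := trunc_log 2 k in
  if k == sparse_index j then eps j * weight k else 0.

Lemma sparse_index_itv j : (2 ^ j <= sparse_index j <= (2 ^ j).+1)%N.
Proof. by rewrite /sparse_index; case: ifP => _; rewrite leqnn leqnSn. Qed.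

Lemma weight_sparse_index j : 1 / 4 <=
  (weight (sparse_index j))%:~R * (`|th (sparse_index j)| * Q (sparse_index j))
  <= 3 / 4.
Proof.
apply: weight_itv; rewrite /sparse_index; case: ifP => // /negP h.
by have [] := err_den_small (2 ^ j).
Qed.

(** For [j = 0] the index may be 2, whose logarithm is 1. *)
Lemma trunc_log_sparse_index j : (0 < j)%N -> trunc_log 2 (sparse_index j) = j.
Proof.
move=> j0; apply: trunc_log_eq => //; have /andP[-> le2] := sparse_index_itv j.
rewrite (leq_ltn_trans le2)// expnS mul2n -addnn.
by have : (2 ^ 1 <= 2 ^ j)%N; [rewrite leq_exp2l|lia].
Qed.

Lemma sparse_coef_index eps j : (0 < j)%N ->
  sparse_coef eps (sparse_index j) = eps j * weight (sparse_index j).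
Proof. by move=> j0; rewrite /sparse_coef trunc_log_sparse_index// eqxx. Qed.

Lemma sparse_coef_gap eps j d : (d.*2.+2 <= j)%N -> forall k,
  k != sparse_index j -> (sparse_index j <= k + d.*2)%N ->
  (k <= sparse_index j + d.*2)%N -> sparse_coef eps k = 0.
Proof.
move=> dj k kj jk kjd; rewrite /sparse_coef; case: eqP => // ki.
move: ki kj jk kjd; move: (trunc_log 2 k) => i -> ij.
have /andP[i1 i2] := sparse_index_itv i.
have /andP[j1 j2] := sparse_index_itv j.
have ij' : i != j by apply: contraNneq ij => ->.
(* Every other sparse index is at distance at least 2^(j-1) - 1 >= j - 1 >= 2d + 1. *)
have jE : (2 ^ j = 2 ^ j.-1 + 2 ^ j.-1)%N.
  by rewrite addnn -mul2n -expnS prednK//; lia.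
have jlt : (j.-1 < 2 ^ j.-1)%N by exact: ltn_expl.
case: (ltngtP i j) ij' => // [lt_ij|lt_ji] _.
  have : (2 ^ i <= 2 ^ j.-1)%N by rewrite leq_exp2l//; lia.
  lia.
have : (2 ^ j.+1 <= 2 ^ i)%N by rewrite leq_exp2l//.
rewrite expnS; lia.
Qed.

Section sparse.
Variable eps : nat -> int.
Hypothesis eps_le1 : forall j, `|eps j| <= 1.

Local Notation X := (ostrowski (sparse_coef eps)).

Lemma sparse_coef_le k : `|(sparse_coef eps k)%:~R| * (`|th k| * Q k) <= 1.
Proof.
rewrite /sparse_coef; case: eqP => [kj|_]; last by rewrite normr0 mul0r.
move: (trunc_log 2 k) kj => j ->; have /andP[_ w34] := weight_sparse_index j.
have w0 : 0 <= (weight (sparse_index j))%:~R :> R by rewrite ler0z.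
rewrite intrM normrM (ger0_norm w0) -mulrA.
have e1 : `|(eps j)%:~R| <= 1 :> R by rewrite -intr_norm lerz1.
apply: (@le_trans _ _ (3 / 4)); last by lra.
by apply: le_trans w34; rewrite ler_piMl// !mulr_ge0// ltW.
Qed.

Lemma is_cvg_sparse : cvgn (series (fun k => (sparse_coef eps k)%:~R * th k)).
Proof. exact: is_cvg_ostrowski sparse_coef_le. Qed.

Lemma dist_int_sparse_ge :
  (forall N, exists2 j, (N <= j)%N & eps j != 0) ->
  forall N, exists2 n, (N <= n)%N & 1 / 8 <= dist_int (Q n * X).
Proof.
(* With d = 6 the error 8 / 2^d is 1/8, half of the distance 1/4 ensured by the weight; 14 = 2d + 2
   is what [sparse_coef_gap] asks for. *)
move=> eps0 N; have [j Nj ej] := eps0 (N + 14)%N.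
have /andP[jn _] := sparse_index_itv j; set n := sparse_index j in jn *.
exists n; first by have := @ltn_expl 2 j isT; lia.
have gap := @sparse_coef_gap eps j 6; rewrite -/n in gap.
have [|z hz] := ostrowski_local sparse_coef_le (gap _); first lia.
have : 1 / 4 <= dist_int ((sparse_coef eps n)%:~R * (Q n * th n)).
  apply: dist_int_ge; first by lra.
  rewrite sparse_coef_index; last by lia.
  have e1 : `|(eps j)%:~R| = 1 :> R.
    rewrite -intr_norm; move: ej (eps_le1 j).
    by case: (eps j) => [[|[|?]]|[|?]].
  have w0 : 0 <= (weight n)%:~R :> R by rewrite ler0z.
  rewrite intrM !normrM e1 mul1r (ger0_norm w0) (gtr0_norm (Q_gt0 n)).
  rewrite [Q n * _]mulrC; have /andP[] := weight_sparse_index j.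
  by rewrite -/n => ? ?; apply/andP; split; lra.
have : dist_int ((sparse_coef eps n)%:~R * (Q n * th n)) <=
    dist_int (Q n * X) + 8 / 2 ^+ 6.
  apply: (@dist_int_near _ _ _ _ (- z)); apply: le_trans hz.
  rewrite -normrN intrN le_eqVlt; apply/orP; left; apply/eqP.
  by congr `|_|; ring.
by rewrite (_ : 8 / 2 ^+ 6 = 1 / 8); [lra|field].
Qed.

Lemma natural_density_sparse e : 0 < e ->
  natural_density [set n | e <= dist_int (Q n * X)] (0 : R).
Proof.
move=> e0; have [d de] : exists d, 8 / 2 ^+ d < e.
  exists (Num.trunc (8 / e)).+1.
  have h : 8 / e < (Num.trunc (8 / e)).+1%:R by apply: truncnS_gt.
  rewrite ltr_pdivrMr ?exprn_gt0// mulrC -ltr_pdivrMr// (lt_trans h)//.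
  by rewrite -natrX ltr_nat ltn_expl.
(* Such an [n] is within 2d of some sparse index k, since otherwise [ostrowski_local] gives a
   distance below [e]. As 2^j <= k <= 2^j + 1, it follows that 2^j <= n + 2d <= 2^j + 4d + 1. *)
apply: (@natural_density_near_exp2 _ _ d.*2 (d.*2.*2).+1) => n /= en.
suff [k ck kn] : exists2 k, sparse_coef eps k != 0 &
    (n <= k + d.*2 /\ k <= n + d.*2)%N.
  move: ck; rewrite /sparse_coef; case: (k =P _) => [ki _|_]; last first.
    by rewrite eqxx.
  exists (trunc_log 2 k); have := sparse_index_itv (trunc_log 2 k).
  by rewrite -ki; move: kn; lia.
apply/not_exists2P => nk.
have c0 k : (n <= k + d.*2)%N -> (k <= n + d.*2)%N -> sparse_coef eps k = 0.
  move=> nk1 nk2; apply/eqP; case: (nk k) => [/negP|]; first by rewrite negbK.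
  by case.
have [|z] := @ostrowski_local _ sparse_coef_le n d.
  by move=> k _; exact: c0.
rewrite c0 ?leq_addr// mul0r => /dist_int_near.
rewrite (dist_int_int (rpred0 _)) add0r => /(le_trans en)/le_lt_trans/(_ de).
by rewrite ltxx.
Qed.

End sparse.
End ostrowski.

(** * Continuum many points *)

(** The Dedekind cut of [x] as a bit sequence, with the rationals enumerated by [unpickle]. *)
Definition cut (R : realType) (x : R) (n : nat) : bool :=
  if unpickle n is Some s then ratr s < x else false.

Lemma cut_inj (R : realType) : injective (@cut R).
Proof.
suff lt_cut (x y : R) : x < y -> cut x <> cut y.
  by move=> x y xy; case: (ltgtP x y) => // /lt_cut; rewrite xy.
move=> /rat_in_itvoo[s]; rewrite in_itv /= => /andP[xs sy].
move=> /(congr1 (fun h => h (pickle s))); rewrite /cut pickleK sy.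
by rewrite ltNge (ltW xs).
Qed.

(* As logn 2 takes every value infinitely often, distinct f give sequences
   that differ infinitely often; the value 1 at odd j ensures that no sequence
   is eventually 0. *)
Definition spread (f : nat -> bool) (j : nat) : int :=
  (if logn 2 j is m.+1 then f m else true) : nat.

Lemma logn2_infinitely_often m N : exists2 j, (N <= j)%N & logn 2 j = m.
Proof.
exists (2 ^ m * N.*2.+1)%N.
  have : (0 < 2 ^ m)%N by rewrite expn_gt0.
  nia.
rewrite lognM ?expn_gt0// pfactorK// logn_coprime ?addn0//.
by rewrite coprime2n /= odd_double.
Qed.

Lemma spread_infinitely_neq0 f N : exists2 j, (N <= j)%N & spread f j != 0.
Proof.
have [j Nj j0] := logn2_infinitely_often 0 N.
by exists j; rewrite // /spread j0.
Qed.

Lemma spreadB_infinitely_neq0 f g N : f <> g ->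
  exists2 j, (N <= j)%N & spread f j - spread g j != 0.
Proof.
move=> fg; have [m fgm] : exists m, f m <> g m.
  by apply/existsNP => fgE; apply: fg; apply/funext.
have [j Nj jm] := logn2_infinitely_often m.+1 N; exists j => //.
by rewrite /spread jm; case: (f m) (g m) fgm => [] [].
Qed.

(** * Transfer to the circle group *)

Section circle.
Variables (R : realType) (alpha : R).
Hypotheses (alpha01 : 0 < alpha < 1) (alpha_irr : irrational alpha).

Local Notation q := (convergent_den alpha).
Local Notation th := (cf_err alpha).

Let q1 := convergent_den_ge1 alpha01 alpha_irr.
Let qS := convergent_den_leS alpha01 alpha_irr.
Let qD := convergent_den_leD alpha01 alpha_irr.
Let qth := cf_err_den alpha01 alpha_irr.
Let qint := cf_err_int alpha01 alpha_irr.

Local Notation X eps := (ostrowski th (sparse_coef q th eps)).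

Lemma circle_norm_pi x n :
  circle_norm ((\pi_(circle R) x)%qT *~ q n) = dist_int ((q n)%:~R * x).
Proof. by rewrite -raddfMz circle_normE mulrzl. Qed.

Lemma spread_le1 f j : `|spread f j| <= 1.
Proof. by rewrite /spread; case: (logn 2 j) => [|m] //; case: (f m). Qed.

Lemma spreadB_le1 f g j : `|spread f j - spread g j| <= 1.
Proof.
by rewrite /spread; case: (logn 2 j) => [|m] //; case: (f m) (g m) => [] [].
Qed.

Lemma pi_spread_mem f : (stat_characterized_subgroup R q `\`
  characterized_subgroup R q) (\pi_(circle R) (X (spread f)))%qT.
Proof.
split=> [e e0|/circle_cvg0P/cvgrPdist_lt].
  under eq_set do rewrite circle_norm_pi.
  exact: (natural_density_sparse q1 qS qD qth qint (spread_le1 f) e0).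
move=> /(_ (1 / 8)) []; first by lra.
move=> N _ near0.
have [n Nn] := dist_int_sparse_ge q1 qS qD qth qint (spread_le1 f)
  (spread_infinitely_neq0 f) N.
have := near0 n Nn; rewrite /= circle_norm_pi sub0r normrN.
by rewrite ger0_norm ?dist_int_ge0// => /lt_le_trans/[apply]; rewrite ltxx.
Qed.

Lemma sparse_coefB eps eps' k :
  sparse_coef q th (fun j => eps j - eps' j) k =
  sparse_coef q th eps k - sparse_coef q th eps' k.
Proof. by rewrite /sparse_coef; case: ifP; rewrite ?subr0 ?mulrBl. Qed.

(** If two images agree, the difference of the expansions is an integer, so all its multiples have
    distance 0 to the integers. But it is itself a sparse expansion with infinitely many nonzero
    digits, against [dist_int_sparse_ge]. *)
Lemma pi_spread_inj :
  injective (fun f => \pi_(circle R) (X (spread f)))%qT.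
Proof.
move=> f g /circle_piP fg; apply: contrapT => fg_neq.
have cvgX h := is_cvg_sparse q1 qS qD qth (spread_le1 h).
have XB : X (spread f) - X (spread g) = X (fun j => spread f j - spread g j).
  rewrite /ostrowski -lim_seriesB; [|exact: cvgX|exact: cvgX].
  congr (limn (series _)); apply/funext => k.
  by rewrite sparse_coefB intrB mulrBl.
have [n _] := dist_int_sparse_ge q1 qS qD qth qint (spreadB_le1 f g)
  (fun N => spreadB_infinitely_neq0 N fg_neq) 0.
rewrite -XB dist_int_int; first by lra.
by rewrite rpredM// intr_int.
Qed.

End circle.

Theorem theoremC (R : realType) (alpha : R)
    (alpha01 : 0 < alpha < 1) (alpha_irr : irrational alpha) :
  stat_characterized_subgroup R (convergent_den alpha)
    `\` characterized_subgroup R (convergent_den alpha) #= [set: R].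
Proof.
apply: Cantor_Bernstein.
  (* Upper bound: representatives embed the circle into the reals. *)
  set A := (_ `\` _); apply/card_subP; exists [set repr x | x in A] => //.
  by apply: inj_card_eq => x y _ _; exact: (can_inj reprK).
(* Lower bound: reals are encoded as bit sequences, and these as sparse expansions. *)
pose F (x : R) := (\pi_(circle R) (ostrowski (cf_err alpha)
  (sparse_coef (convergent_den alpha) (cf_err alpha) (spread (cut x)))))%qT.
apply/card_subP; exists (range F); last first.
  by move=> _ [x _ <-]; exact: pi_spread_mem.
apply: inj_card_eq => x y _ _ Fxy; apply: cut_inj.
exact: (pi_spread_inj alpha01 alpha_irr Fxy).
Qed.
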